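(* Let $\alpha_i\ge 0$, $\beta_i>0$ ($1\le i\le 5$) and $Q>0$ be real numbers, and consider the networks $N$ and $N^+$ with these parameters and total flow $Q$. Suppose that at equilibria $N$ has no path with vanishing flow and $P_1$ is the only path with vanishing flow in $N^+$. Then Braess' paradox occurs in $N/N^+$ (i.e. $T^+_{Eq}>T_{Eq}$) if and only if $\mathcal B_3>0$ and $$\max\left\{\frac{\alpha}{\beta_{12}},\ \frac{-\alpha}{\beta_{45}},\ \frac{\bar\alpha}{\beta_{13}},\ \frac{-\bar\alpha}{\beta_4},\ \frac{\bar\alpha\beta_4\beta-\alpha\beta_{134}\beta_{45}}{\mathcal B_3}\right\} < Q \le \mu_1.$$
   Context: The network $N^+$ has nodes $a,b,c,d$ and directed links $(a,b),(b,d),(b,c),(a,c),(c,d)$ with travel times $\alpha_1+\beta_1f_{ab}$, $\alpha_2+\beta_2f_{bd}$, $\alpha_3+\beta_3f_{bc}$, $\alpha_4+\beta_4f_{ac}$, $\alpha_5+\beta_5f_{cd}$ respectively, where $f_{ij}\ge 0$ is the (real) flow on link $(i,j)$ and $\alpha_i\ge 0$, $\beta_i>0$. All traffic, of total amount $Q>0$ (real), goes from $a$ to $d$ along the paths $P_1=a-b-d$, $P_2=a-c-d$, $P_3=a-b-c-d$. The network $N$ is $N^+$ with the link $(b,c)$ removed, so its paths are $P_1,P_2$ only. A flow assigns a non-negative real amount to each path, with total $Q$; the flow on a link is the sum of the flows of the paths containing it; the travel time on a path is the sum of the travel times of its links. A path has vanishing flow if its path flow is $0$, and non-vanishing flow otherwise.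 A network is at equilibrium if all paths with non-vanishing flow have the same travel time, and every path with vanishing flow has travel time at least this common value. The equilibrium exists and is unique; its common travel time is denoted $T_{Eq}$ for $N$ and $T^+_{Eq}$ for $N^+$. Braess' paradox is said to occur in $N/N^+$ for the total flow $Q$ if $T^+_{Eq}>T_{Eq}$. Notation: multiple indices denote sums, e.g. $\alpha_{ij}=\alpha_i+\alpha_j$, $\beta_{134}=\beta_1+\beta_3+\beta_4$. Further, $\alpha=\alpha_{45}-\alpha_{12}$, $\bar\alpha=\alpha_4-\alpha_{13}$, $\hat\alpha=\alpha_2-\alpha_{35}$, $\beta=\beta_1+\beta_2+\beta_4+\beta_5$, $\mathcal B_3=\beta_{45}^2\beta_{134}-\beta_4^2\beta$, and $$\mu_1=\frac{\hat\alpha\beta_{14}-\alpha\beta_3}{\beta_3\beta_{45}+\beta_5\beta_{14}}.$$ *)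

(* Defs.v *)
From HB Require Import structures.
From mathcomp Require Import all_boot all_order all_algebra reals.
Set Implicit Arguments. Unset Strict Implicit. Unset Printing Implicit Defensive.
Import Order.TTheory GRing.Theory Num.Theory.
Local Open Scope ring_scope.

(* The links (a,b), (b,d), (b,c), (a,c), (c,d), in the order of the indices
   1, ..., 5 of the parameters alpha_i, beta_i. *)
Inductive link := ab | bd | bc | ac | cd.

Definition link_comparable : comparable link.
Proof. by rewrite /comparable /decidable; decide equality. Defined.

HB.instance Definition _ := hasDecEq.Build link (compareP link_comparable).

Definition route := seq link.

Definition P1 : route := [:: ab; bd].
Definition P2 : route := [:: ac; cd].
Definition P3 : route := [:: ab; bc; cd].

(* All traffic goes from a to d, so a network is represented by its list of
   a-d paths; removing a link removes the paths through it. *)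
Definition network := seq route.

Definition Nplus : network := [:: P1; P2; P3].
Definition N : network := [seq p <- Nplus | bc \notin p].

Section Equilibrium.
Variables (R : realType) (alpha beta : link -> R) (net : network).

(* Path flows are total functions on [route]; only their values on the paths
   of [net] are ever used. *)
Implicit Types (f : route -> R) (p : route) (Q T : R).

Definition link_flow f (l : link) : R := \sum_(p <- net | l \in p) f p.

Definition link_time f (l : link) : R := alpha l + beta l * link_flow f l.

Definition path_time f p : R := \sum_(l <- p) link_time f l.

Definition is_flow Q f : Prop :=
  (forall p, p \in net -> 0 <= f p) /\ \sum_(p <- net) f p = Q.

Definition vanishing f p : Prop := f p = 0.

(* For 0 < Q some path has non-vanishing flow, so f determines T. *)
Definition equilibrium_at Q f T : Prop :=
  [/\ is_flow Q f,
      forall p, p \in net -> ~ vanishing f p -> path_time f p = T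
    & forall p, p \in net -> vanishing f p -> T <= path_time f p].

Definition equilibrium Q f : Prop := exists T, equilibrium_at Q f T.

(* When 0 < Q and all beta l > 0, the equilibrium exists and is unique, and
   exactly one T satisfies this predicate. *)
Definition equilibrium_time Q T : Prop := exists f, equilibrium_at Q f T.

End Equilibrium.

Definition braess_paradox (R : realType) (alpha beta : link -> R) (Q : R)
  : Prop :=
  exists T Tplus : R,
    [/\ equilibrium_time alpha beta N Q T,
        equilibrium_time alpha beta Nplus Q Tplus
      & Tplus > T].

(* Main.v *)
(* The equilibrium time is unique, so the paradox is a comparison of the times
   of the two given equilibria. On the paths in use the equilibrium equations
   are linear; solving them gives
     b (b1 + b3 + b4) (Tplus - T)
       = B3 Q - (abar b4 b - a (b1 + b3 + b4) (b4 + b5)).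
   Positivity of the used flows gives the first four lower bounds on Q, and the
   optimality of leaving P1 unused is Q <= mu1. The latter also excludes
   B3 <= 0 when the right-hand side above is positive. *)
Require Import Defs.
From HB Require Import structures.
From mathcomp Require Import all_boot all_order all_algebra reals.
From mathcomp Require Import ring lra.
Set Implicit Arguments. Unset Strict Implicit. Unset Printing Implicit Defensive.
Import Order.TTheory GRing.Theory Num.Theory.
Local Open Scope ring_scope.

(** * Uniqueness of the equilibrium time in an arbitrary network *)

(** Exchange of summation over paths and links. As paths are duplicate-free, a sum along [p] is a
    sum over the links with [l \in p], which is how [link_flow] counts; [undup (flatten net)] lists
    the links met by some path. *)
Lemma sum_path_time_link (R : realType) (net : network) (h : route -> R)
    (t : link -> R) :
  all uniq net ->
  \sum_(p <- net) h p * (\sum_(l <- p) t l) =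
  \sum_(l <- undup (flatten net)) t l * link_flow net h l.
Proof.
move=> /allP net_uniq.
transitivity (\sum_(p <- net) \sum_(l <- undup (flatten net) | l \in p)
                t l * h p).
  rewrite big_seq [RHS]big_seq; apply: eq_bigr => p p_net.
  rewrite -mulr_suml mulrC; congr (_ * _).
  rewrite -[RHS]big_filter; apply: perm_big; apply: uniq_perm.
  - exact: net_uniq.
  - exact/filter_uniq/undup_uniq.
  move=> l; rewrite mem_filter mem_undup; case: (boolP (l \in p)) => //= lp.
  by apply/esym/flattenP; exists p.
rewrite (exchange_big_dep predT) //=.
by apply: eq_bigr => l _; rewrite mulr_sumr.
Qed.

Lemma equilibrium_time_min (R : realType) (alpha beta : link -> R)
    (net : network) (Q T : R) (f : route -> R) (p : route) :
  equilibrium_at alpha beta net Q f T -> p \in net ->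
  T <= path_time alpha beta net f p.
Proof.
move=> [_ used unused] p_net; have [fp0|/eqP fpN0] := eqVneq (f p) 0.
  exact: unused.
by rewrite used.
Qed.

Lemma equilibrium_total_time (R : realType) (alpha beta : link -> R)
    (net : network) (Q T : R) (f : route -> R) :
  equilibrium_at alpha beta net Q f T ->
  \sum_(p <- net) f p * path_time alpha beta net f p = Q * T.
Proof.
move=> [[_ <-] used _]; rewrite mulr_suml big_seq [RHS]big_seq.
apply: eq_bigr => p p_net; have [->|/eqP fpN0] := eqVneq (f p) 0.
  by rewrite !mul0r.
by rewrite used.
Qed.

(** Variational inequality: with travel times frozen at [f], no path takes less than [T], so no
    rerouting [g] can do better on average. *)
Lemma equilibrium_total_time_le (R : realType) (alpha beta : link -> R)
    (net : network) (Q T Q' : R) (f g : route -> R) :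
  equilibrium_at alpha beta net Q f T -> is_flow net Q' g ->
  Q' * T <= \sum_(p <- net) g p * path_time alpha beta net f p.
Proof.
move=> eqf [g_ge0 <-]; rewrite mulr_suml big_seq [leRHS]big_seq.
apply: ler_sum => p p_net; apply: ler_wpM2l; first exact: g_ge0.
exact: equilibrium_time_min eqf p_net.
Qed.

(* Pairing the difference of the path flows with the difference of the path
   times gives a weighted sum of squares of link flow differences; the
   equilibrium conditions make it nonpositive. *)
Lemma equilibrium_path_time_unique (R : realType) (alpha beta : link -> R)
    (net : network) (Q T T' : R) (f g : route -> R) (p : route) :
  (forall l, 0 < beta l) -> all uniq net ->
  equilibrium_at alpha beta net Q f T ->
  equilibrium_at alpha beta net Q g T' -> p \in net ->
  path_time alpha beta net f p = path_time alpha beta net g p.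
Proof.
move=> beta_gt0 net_uniq eqf eqg p_net.
pose d l := link_flow net f l - link_flow net g l.
have dE : link_flow net (fun q => f q - g q) =1 d.
  by move=> l; rewrite /link_flow sumrB.
have sum_le0 : \sum_(l <- undup (flatten net)) beta l * d l * d l <= 0.
  under eq_bigr => l _ do rewrite -[X in _ * X]dE.
  rewrite -sum_path_time_link //.
  have flow_f : is_flow net Q f by case: eqf.
  have flow_g : is_flow net Q g by case: eqg.
  have := equilibrium_total_time_le eqf flow_g.
  have := equilibrium_total_time_le eqg flow_f.
  have := equilibrium_total_time eqf; have := equilibrium_total_time eqg.
  (* The two pure sums equal [Q * T] and [Q * T'], and the two mixed sums, entering with a minus
     sign, are at least [Q * T'] and [Q * T]. *)
  suff -> : \sum_(q <- net) (f q - g q) * (\sum_(l <- q) beta l * d l) =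
      \sum_(q <- net) f q * path_time alpha beta net f q
      - \sum_(q <- net) f q * path_time alpha beta net g q
      - \sum_(q <- net) g q * path_time alpha beta net f q
      + \sum_(q <- net) g q * path_time alpha beta net g q by lra.
  rewrite -!sumrB -big_split /=; apply: eq_bigr => q _.
  suff -> : \sum_(l <- q) beta l * d l =
      path_time alpha beta net f q - path_time alpha beta net g q by ring.
  by rewrite /path_time -sumrB; apply: eq_bigr => l _;
     rewrite /link_time /d; ring.
have term_ge0 l : 0 <= beta l * d l * d l.
  by rewrite -mulrA mulr_ge0 -?expr2 ?sqr_ge0 ?ltW.
have /eqP : \sum_(l <- undup (flatten net)) beta l * d l * d l = 0.
  by apply/le_anti; rewrite sum_le0 sumr_ge0.
rewrite psumr_eq0 // => /allP d0.
rewrite /path_time big_seq [RHS]big_seq; apply: eq_bigr => l lp.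
have /d0 /= : l \in undup (flatten net).
  by rewrite mem_undup; apply/flattenP; exists p.
rewrite !mulf_eq0 (gt_eqF (beta_gt0 l)) /= orbb subr_eq0 => /eqP.
by rewrite /link_time => ->.
Qed.

(** A path used by one equilibrium has the same time at the other, where no path beats the other
    common time; this gives one inequality, and symmetry the second. A used path exists because
    [0 < Q]. *)
Lemma equilibrium_time_unique (R : realType) (alpha beta : link -> R)
    (net : network) (Q T T' : R) :
  (forall l, 0 < beta l) -> all uniq net -> 0 < Q ->
  equilibrium_time alpha beta net Q T -> equilibrium_time alpha beta net Q T' ->
  T = T'.
Proof.
move=> beta_gt0 net_uniq Q_gt0.
suff le_T S S' : equilibrium_time alpha beta net Q S ->
    equilibrium_time alpha beta net Q S' -> S' <= S.
  by move=> eqT eqT'; apply/le_anti/andP; split; apply: le_T.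
move=> [f eqf] [g eqg].
have [p p_net fpN0] : exists2 p, p \in net & f p != 0.
  apply/hasP; apply: contraTT Q_gt0 => /hasPn f0.
  case: eqf => -[_ <-] _ _; rewrite big_seq big1 ?ltxx // => p p_net.
  by apply/eqP; rewrite -[_ == _]negbK f0.
have -> : S = path_time alpha beta net f p.
  by case: eqf => _ -> //; apply/eqP.
rewrite (equilibrium_path_time_unique beta_gt0 net_uniq eqf eqg p_net).
exact: equilibrium_time_min eqg p_net.
Qed.

(** * The path times of [N] and [Nplus] *)

Lemma N_E : N = [:: P1; P2].
Proof. by []. Qed.

Lemma path_time_N (R : realType) (alpha beta : link -> R) (f : route -> R) :
  (path_time alpha beta N f P1 =
     alpha ab + alpha bd + (beta ab + beta bd) * f P1) *
  (path_time alpha beta N f P2 =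
     alpha ac + alpha cd + (beta ac + beta cd) * f P2).
Proof.
by rewrite N_E /path_time /link_time /link_flow !(big_cons, big_nil) /=;
   split; ring.
Qed.

Lemma path_time_Nplus (R : realType) (alpha beta : link -> R)
    (f : route -> R) :
  [/\ path_time alpha beta Nplus f P1 =
        alpha ab + beta ab * (f P1 + f P3) + (alpha bd + beta bd * f P1),
      path_time alpha beta Nplus f P2 =
        alpha ac + beta ac * f P2 + (alpha cd + beta cd * (f P2 + f P3))
    & path_time alpha beta Nplus f P3 =
        alpha ab + beta ab * (f P1 + f P3) + (alpha bc + beta bc * f P3)
        + (alpha cd + beta cd * (f P2 + f P3))].
Proof.
by rewrite /path_time /link_time /link_flow !(big_cons, big_nil) /=;
   split; ring.
Qed.

(* When B3 <= 0 the difference b4 b2 - b5 b1 is nonnegative, so the bound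
   obtained from mu1 is weakest at abar = - b4 Q, where it becomes an equality. *)
Lemma B3_gt0_of_threshold (R : realType) (a abar b1 b2 b3 b4 b5 Q : R) :
  let b := b1 + b2 + b4 + b5 in
  let B3 := (b4 + b5) ^+ 2 * (b1 + b3 + b4) - b4 ^+ 2 * b in
  0 < b1 -> 0 < b2 -> 0 < b3 -> 0 < b4 -> 0 < b5 ->
  - abar < b4 * Q ->
  Q * (b3 * (b4 + b5) + b5 * (b1 + b4)) <=
    (abar - a) * (b1 + b4) - a * b3 ->
  abar * b4 * b - a * (b1 + b3 + b4) * (b4 + b5) < B3 * Q ->
  0 < B3.
Proof.
move=> b B3 b1_gt0 b2_gt0 b3_gt0 b4_gt0 b5_gt0 abar_gt le_mu1.
apply: contraTT; rewrite -!leNgt => B3_le0.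
have minor_ge0 : 0 <= b4 * b2 - b5 * b1.
  rewrite -(pmulr_rge0 _ b4_gt0).
  have -> : b4 * (b4 * b2 - b5 * b1) =
    - B3 + (b4 ^+ 2 * b3 + b4 * b5 * b1 + b4 ^+ 2 * b5
            + 2 * (b4 * b5 * b3) + b5 ^+ 2 * (b1 + b3 + b4)).
    by rewrite /B3 /b; ring.
  have ? := ltW b1_gt0; have ? := ltW b3_gt0; have ? := ltW b4_gt0.
  have ? := ltW b5_gt0.
  rewrite addr_ge0 ?oppr_ge0 //.
  by rewrite !(addr_ge0, mulr_ge0, exprn_ge0).
have b45_gt0 : 0 < b4 + b5 by rewrite addr_gt0.
move: le_mu1; rewrite -(ler_pM2l b45_gt0) -subr_ge0 => le_mu1.
have prod_ge0 : 0 <= (b4 * Q + abar) * (b4 * b2 - b5 * b1).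
  by apply: mulr_ge0 => //; lra.
(* The slack of the goal is exactly this sum; scaling the bound from [mu1] by [b4 + b5] was chosen
   to match the coefficients of [a]. *)
rewrite -subr_ge0 /B3 /b; have := addr_ge0 prod_ge0 le_mu1.
by congr (0 <= _); ring.
Qed.

Theorem theorem3 (R : realType) (alpha beta : link -> R) (Q : R)
  (f fplus : route -> R)
  (halpha : forall l, 0 <= alpha l)
  (hbeta : forall l, 0 < beta l)
  (hQ : 0 < Q)
  (hf : equilibrium alpha beta N Q f)
  (hfplus : equilibrium alpha beta Nplus Q fplus)
  (hN : forall p, p \in N -> ~ vanishing f p)
  (hNplus : forall p, p \in Nplus -> (vanishing fplus p <-> p = P1)) :
  let a1 := alpha ab in let a2 := alpha bd in let a3 := alpha bc in
  let a4 := alpha ac in let a5 := alpha cd in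
  let b1 := beta ab in let b2 := beta bd in let b3 := beta bc in
  let b4 := beta ac in let b5 := beta cd in
  let a := (a4 + a5) - (a1 + a2) in
  let abar := a4 - (a1 + a3) in
  let ahat := a2 - (a3 + a5) in
  let b := b1 + b2 + b4 + b5 in
  let B3 := (b4 + b5) ^+ 2 * (b1 + b3 + b4) - b4 ^+ 2 * b in
  let mu1 := (ahat * (b1 + b4) - a * b3)
             / (b3 * (b4 + b5) + b5 * (b1 + b4)) in
  braess_paradox alpha beta Q <->
  0 < B3 /\
  Num.max (a / (b1 + b2))
    (Num.max (- a / (b4 + b5))
      (Num.max (abar / (b1 + b3))
        (Num.max (- abar / b4)
          ((abar * b4 * b - a * (b1 + b3 + b4) * (b4 + b5)) / B3))))
    < Q <= mu1.
Proof.
move=> a1 a2 a3 a4 a5 b1 b2 b3 b4 b5 a abar ahat b B3 mu1.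
have [T eqT] := hf; have [T' eqT'] := hfplus.
have b1_gt0 : 0 < b1 := hbeta _; have b2_gt0 : 0 < b2 := hbeta _.
have b3_gt0 : 0 < b3 := hbeta _; have b4_gt0 : 0 < b4 := hbeta _.
have b5_gt0 : 0 < b5 := hbeta _.
have paradoxE : braess_paradox alpha beta Q <-> T < T'.
  split=> [[S [S' [eqS eqS' ltS]]]|ltT]; last first.
    by exists T, T'; split; [exists f | exists fplus |].
  have <- : S = T by apply: (equilibrium_time_unique hbeta _ hQ eqS); [|exists f].
  by have <- : S' = T'
    by apply: (equilibrium_time_unique hbeta _ hQ eqS'); [|exists fplus].
rewrite {}paradoxE.
have [tN1 tN2] := path_time_N alpha beta f.
have [x_gt0 y_gt0 sumxy TE1 TE2] : [/\ 0 < f P1, 0 < f P2, f P1 + f P2 = Q,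
    T = a1 + a2 + (b1 + b2) * f P1 & T = a4 + a5 + (b4 + b5) * f P2].
  case: eqT => -[f_ge0 sumf] used _.
  have P1N : P1 \in N by [].
  have P2N : P2 \in N by [].
  split.
  - by rewrite lt_neqAle f_ge0 // andbT eq_sym; apply/eqP/hN.
  - by rewrite lt_neqAle f_ge0 // andbT eq_sym; apply/eqP/hN.
  - by rewrite -sumf N_E !big_cons big_nil addr0.
  - by rewrite -tN1 used //; apply: hN.
  - by rewrite -tN2 used //; apply: hN.
have [tP1 tP2 tP3] := path_time_Nplus alpha beta fplus.
have [u_gt0 v_gt0 sumuv] : [/\ 0 < fplus P2, 0 < fplus P3 &
    fplus P2 + fplus P3 = Q].
  case: eqT' => -[f_ge0 sumf] used _.
  have nz p : p \in Nplus -> p != P1 -> 0 < fplus p.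
    move=> pN /eqP pN1; rewrite lt_neqAle f_ge0 // andbT eq_sym.
    by apply/eqP => /(hNplus p pN).
  split; try exact: nz.
  rewrite -sumf !big_cons big_nil addr0.
  have -> : fplus P1 = 0 by apply/(hNplus P1).
  by rewrite add0r.
have w0 : fplus P1 = 0 by apply/(hNplus P1).
have [T'E2 T'E3 T'le] : [/\ T' = a4 + b4 * fplus P2 + (a5 + b5 * Q),
   T' = a1 + b1 * fplus P3 + (a3 + b3 * fplus P3) + (a5 + b5 * Q) &
   T' <= a1 + b1 * fplus P3 + a2].
  move: tP1 tP2 tP3; rewrite w0 add0r sumuv mulr0 addr0 => tP1 tP2 tP3.
  case: eqT' => _ used unused; split.
  - by rewrite -tP2 used //; apply/(hNplus P2).
  - by rewrite -tP3 used //; apply/(hNplus P3).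
  - by rewrite -tP1 unused.
(* From here on only real numbers matter: [x], [y] are the flows on [P1], [P2] in [N], and [u], [v]
   those on [P2], [P3] in [Nplus]. *)
move: (f P1) (f P2) (fplus P2) (fplus P3) x_gt0 y_gt0 u_gt0 v_gt0
  sumxy sumuv TE1 TE2 T'E2 T'E3 T'le => x y u v x_gt0 y_gt0 u_gt0 v_gt0
  sumxy sumuv TE1 TE2 T'E2 T'E3 T'le.
clear - b1_gt0 b2_gt0 b3_gt0 b4_gt0 b5_gt0 hQ x_gt0 y_gt0 u_gt0 v_gt0
  sumxy sumuv TE1 TE2 T'E2 T'E3 T'le.
have b_gt0 : 0 < b by rewrite !addr_gt0.
have b134_gt0 : 0 < b1 + b3 + b4 by rewrite !addr_gt0.
(* The equilibrium flows are kept with cleared denominators [b] and [b1 + b3 + b4]. *)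
have xE : b * x = (b4 + b5) * Q + a.
  by move: TE1; rewrite TE2 /b /a -sumxy => ?; lra.
have yE : b * y = (b1 + b2) * Q - a.
  by move: TE1; rewrite TE2 /b /a -sumxy => ?; lra.
have vE : (b1 + b3 + b4) * v = b4 * Q + abar.
  by move: T'E3; rewrite T'E2 /abar -sumuv => ?; lra.
have uE : (b1 + b3 + b4) * u = (b1 + b3) * Q - abar.
  by move: T'E3; rewrite T'E2 /abar -sumuv => ?; lra.
have a_lt : a < (b1 + b2) * Q by rewrite -subr_gt0 -yE mulr_gt0.
have a_gt : - a < (b4 + b5) * Q.
  by rewrite -subr_gt0 opprK -xE mulr_gt0.
have abar_lt : abar < (b1 + b3) * Q by rewrite -subr_gt0 -uE mulr_gt0.
have abar_gt : - abar < b4 * Q by rewrite -subr_gt0 opprK -vE mulr_gt0.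
have ahatE : ahat = abar - a by rewrite /ahat /abar /a; ring.
have den_gt0 : 0 < b3 * (b4 + b5) + b5 * (b1 + b4).
  by rewrite !(addr_gt0, mulr_gt0).
have le_mu1 : Q * (b3 * (b4 + b5) + b5 * (b1 + b4)) <=
    (abar - a) * (b1 + b4) - a * b3.
  (* [P3] is no slower than [P1], and the time on their shared link [ab] cancels. *)
  have : b3 * v + b5 * Q <= ahat by rewrite /ahat; lra.
  rewrite ahatE -(ler_pM2l b134_gt0).
  have -> : (b1 + b3 + b4) * (b3 * v + b5 * Q) =
    b3 * ((b1 + b3 + b4) * v) + (b1 + b3 + b4) * b5 * Q by ring.
  by rewrite vE => ?; lra.
have gapE : b * (b1 + b3 + b4) * (T' - T) =
    B3 * Q - (abar * b4 * b - a * (b1 + b3 + b4) * (b4 + b5)).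
  rewrite T'E2 TE2.
  (* Regrouped so that [u] and [y] appear with the factors of [uE] and [yE]. *)
  transitivity (b * b4 * ((b1 + b3 + b4) * u) + b * (b1 + b3 + b4) * b5 * Q
    - (b1 + b3 + b4) * (b4 + b5) * (b * y)); first by ring.
  by rewrite uE yE /B3 /b; ring.
have -> : (T < T') =
    (abar * b4 * b - a * (b1 + b3 + b4) * (b4 + b5) < B3 * Q).
  by rewrite -[RHS]subr_gt0 -gapE pmulr_rgt0 ?mulr_gt0 // subr_gt0.
(* Once [B3] is positive, the gap inequality is the last entry of the maximum; the other bounds
   already follow from the equilibrium conditions. *)
split=> [gap|[B3_gt0]]; last first.
  by rewrite !gt_max => /andP[/and5P[_ _ _ _]]; rewrite ltr_pdivrMr // [Q * _]mulrC.
have B3_gt0 : 0 < B3.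
  exact: (B3_gt0_of_threshold b1_gt0 b2_gt0 b3_gt0 b4_gt0 b5_gt0 abar_gt
    le_mu1 gap).
split=> //; rewrite /mu1 ler_pdivlMr // ahatE le_mu1 andbT.
by rewrite !gt_max !ltr_pdivrMr ?B3_gt0 ?addr_gt0 // ![Q * _]mulrC a_lt a_gt
  abar_lt abar_gt.
Qed.
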